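(* Let $n\ge N\ge2$, let $t^{1/2}$ be a nonzero complex number and $p>0$. Fix positive integers $d_0,\dots,d_{N-1}$ with $\sum_{j=0}^{N-1}d_j=n$ and set $\delta=(0^{d_0},1^{d_1},\dots,(N-1)^{d_{N-1}})$. Fix a sign: either $\eta=t^{1/2}$ (sign $(+)$) or $\eta=-t^{-1/2}$ (sign $(-)$). Suppose $E\in P_n$ satisfies $$\widehat Y_jE=\chi_jE\quad(1\le j\le n),\qquad \widehat T_iE=\eta E\quad\text{for all } 1\le i\le n-1\text{ with }\delta_i=\delta_{i+1},$$ for some constants $\chi_j$. For $\epsilon\in I_{d_0,\dots,d_{N-1}}$ set $f_\epsilon:=(\widehat T_{w_\epsilon^-})^{-1}E$. Then $\{f_\epsilon\}$ is a qKZ family of the chosen sign with exponents $c_i=\chi_{d_0+\cdots+d_i}\,\eta^{d_i-1}$ $(0\le i\le N-1)$.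
   Context: $P_n=\mathbb{C}[z_1^{\pm1},\dots,z_n^{\pm1}]$. For $1\le i\le n-1$, $\tau_i$ swaps $z_i,z_{i+1}$; $\widehat T_i:=t^{1/2}\tau_i+\frac{t^{1/2}-t^{-1/2}}{z_i/z_{i+1}-1}(\tau_i-1)$ (an invertible operator on $P_n$), and $(\omega f)(z_1,\dots,z_n):=f(pz_n,z_1,\dots,z_{n-1})$. For $w\in S_n$ with reduced expression $w=s_{i_1}\cdots s_{i_m}$ ($s_i=(i,i+1)$), $\widehat T_w:=\widehat T_{i_1}\cdots\widehat T_{i_m}$ (independent of the reduced expression). The $q$-Dunkl operators are $\widehat Y_j:=\widehat T_j\cdots\widehat T_{n-1}\,\omega\,\widehat T_1^{-1}\cdots\widehat T_{j-1}^{-1}$. $S_n$ acts on $\mathbb{Z}^n$ by $\sigma\lambda=(\lambda_{\sigma^{-1}(1)},\dots,\lambda_{\sigma^{-1}(n)})$. For $\lambda\in\mathbb{Z}^n$, $\lambda^-$ is the unique weakly increasing element of $S_n\lambda$ and $w_\lambda^-$ is the shortest $w\in S_n$ with $w\lambda=\lambda^-$. $I_{d_0,\dots,d_{N-1}}$ is the set of $\epsilon\in\{0,\dots,N-1\}^n$ with $\#\{a:\epsilon_a=j\}=d_j$ for each $j$. A family $\{f_\epsilon\in P_n\}_{\epsilon\in I_{d_0,\dots,d_{N-1}}}$ is a qKZ family of sign $(+)$ (resp. $(-)$) with exponents $(c_0,\dots,c_{N-1})$ if: (i) whenever $\epsilon_i=\epsilon_{i+1}$, $\widehat T_if_\epsilon=t^{1/2}f_\epsilon$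 (resp. $-t^{-1/2}f_\epsilon$); (ii) whenever $\epsilon_i>\epsilon_{i+1}$, $\widehat T_if_{(\dots,\epsilon_i,\epsilon_{i+1},\dots)}=f_{(\dots,\epsilon_{i+1},\epsilon_i,\dots)}$; (iii) $\omega f_{(\epsilon_n,\epsilon_1,\dots,\epsilon_{n-1})}=c_{\epsilon_n}f_{(\epsilon_1,\dots,\epsilon_n)}$ for all $\epsilon$. *)

(* Defs.v *)
From HB Require Import structures.
From mathcomp Require Import all_boot all_order all_algebra.
From mathcomp Require Import fingroup perm finmap.
From mathcomp Require Import reals.
From mathcomp Require Import complex.
From Stdlib Require Import ClassicalEpsilon.

Set Implicit Arguments.
Unset Strict Implicit.
Unset Printing Implicit Defensive.

Import Order.TTheory GRing.Theory Num.Theory.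
Local Open Scope ring_scope.

(* Conventions: everything is 0-based.
   Variables z_0, ..., z_{n-1}; T i (i.+1 < n) exchanges z_i and z_{i+1};
   colours 0..N-1; positions of epsilon are 0..n-1.                         *)

Section LaurentDefs.
Variable R : realType.
Local Notation C := R[i].
Variable n : nat.

Definition expo := {ffun 'I_n -> int}.

(* P_n = C[z_0^{+-1}, ..., z_{n-1}^{+-1}] : finitely supported coefficient
   families indexed by exponent vectors. *)
Definition LP := {fsfun expo -> C with 0}.

Definition lp0 : LP := [fsfun].

Definition lev (f : LP) (z : nat -> C) : C :=
  \sum_(a <- finsupp f) f a * \prod_(k < n) (z k) ^ (a k).

Definition torus (z : nat -> C) := forall k, (k < n)%N -> z k != 0.

(* the Laurent polynomial satisfying a given (uniquely determining) property *)
Definition lp_such (P : LP -> Prop) : LP := epsilon (inhabits lp0) P.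

Definition lp_scaled (g : LP) (c : C) (f : LP) := forall a, g a = c * f a.

Definition zswap (i : nat) (z : nat -> C) : nat -> C :=
  fun k => if k == i then z i.+1 else if k == i.+1 then z i else z k.

Definition zrot (p : R) (z : nat -> C) : nat -> C :=
  fun k => if k == 0%N then (p%:C)%C * z n.-1 else z k.-1.

Definition tau (i : nat) (f : LP) : LP :=
  lp_such (fun g => forall z, torus z -> lev g z = lev f (zswap i z)).

Definition omega (p : R) (f : LP) : LP :=
  lp_such (fun g => forall z, torus z -> lev g z = lev f (zrot p z)).

(* hat T_i = t^{1/2} tau_i + (t^{1/2} - t^{-1/2}) / (z_i/z_{i+1} - 1) (tau_i - 1);
   the result is the Laurent polynomial agreeing with this rational
   expression at every point of the torus off the hyperplane z_i = z_{i+1}. *)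
Definition That (ts : C) (i : nat) (f : LP) : LP :=
  lp_such (fun g => forall z, torus z -> z i != z i.+1 ->
    lev g z = ts * lev f (zswap i z)
              + (ts - ts^-1) / (z i / z i.+1 - 1) * (lev f (zswap i z) - lev f z)).

Definition Tinv (ts : C) (i : nat) (f : LP) : LP :=
  lp_such (fun g => That ts i g = f).

Definition Yop (ts : C) (p : R) (j : nat) (f : LP) : LP :=
  foldr (That ts) (omega p (foldr (Tinv ts) f (iota 0 j))) (iota j (n.-1 - j)).

Definition sw (i : nat) (k : 'I_n) : 'I_n :=
  insubd k (if val k == i then i.+1 else if val k == i.+1 then i else val k).

Definition plen (w : {perm 'I_n}) : nat :=
  #|[set q : 'I_n * 'I_n | (q.1 < q.2)%N && (w q.2 < w q.1)%N]|.

Definition reduced_word (w : {perm 'I_n}) (word : seq nat) :=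
  all (fun i => i.+1 < n)%N word /\
  (forall k, w k = foldr sw k word) /\ size word = plen w.

Definition rword (w : {perm 'I_n}) : seq nat :=
  epsilon (inhabits [::]) (reduced_word w).

Definition Tw_inv (ts : C) (w : {perm 'I_n}) (f : LP) : LP :=
  foldl (fun g i => Tinv ts i g) f (rword w).

Definition pact (w : {perm 'I_n}) (lam : seq nat) : seq nat :=
  [seq nth 0%N lam ((w^-1)%g k) | k <- enum 'I_n].

Definition is_wminus (lam : seq nat) (w : {perm 'I_n}) :=
  sorted leq (pact w lam) /\
  forall w', sorted leq (pact w' lam) -> (plen w <= plen w')%N.

Definition wminus (lam : seq nat) : {perm 'I_n} :=
  epsilon (inhabits 1%g) (is_wminus lam).

Definition inI (N : nat) (d : nat -> nat) (e : seq nat) :=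
  size e = n /\ all (fun x => x < N)%N e /\
  forall j, (j < N)%N -> count_mem j e = d j.

Definition sswap (i : nat) (e : seq nat) : seq nat :=
  set_nth 0%N (set_nth 0%N e i (nth 0%N e i.+1)) i.+1 (nth 0%N e i).

Definition eta_of (sg : bool) (ts : C) : C := if sg then ts else - ts^-1.

Definition qKZ_family (ts : C) (p : R) (N : nat) (d : nat -> nat)
    (sg : bool) (c : nat -> C) (f : seq nat -> LP) :=
  (forall e, inI N d e -> forall i, (i.+1 < n)%N ->
     nth 0%N e i = nth 0%N e i.+1 ->
     lp_scaled (That ts i (f e)) (eta_of sg ts) (f e)) /\
  (forall e, inI N d e -> forall i, (i.+1 < n)%N ->
     (nth 0%N e i.+1 < nth 0%N e i)%N ->
     That ts i (f e) = f (sswap i e)) /\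
  (forall e, inI N d e ->
     lp_scaled (omega p (f (rotr 1 e))) (c (nth 0%N e n.-1)) (f e)).

End LaurentDefs.

Definition delta (N : nat) (d : nat -> nat) : seq nat :=
  flatten [seq nseq (d j) j | j <- iota 0 N].

(* Main.v *)
(* All identities between the operators are checked by evaluation at points
   with nonzero, pairwise distinct coordinates, which determine a Laurent
   polynomial. This gives the Hecke relations for the [That i] (quadratic, hence
   invertible, commutation, braid) and [omega T_(i+1) = T_i omega].
   A reduced word of the shortest permutation sorting [e] performs one strict
   descent of [e] at a time, and the braid relations make
   [f_e = T_(w_e)^-1 E] independent of the choice of descents; so
   [T_i f_e = f_(s_i e)] at each descent. The eigenvalue relation at a plateau of
   [e] is carried from the sorted sequence to [e] by braid moves. For the cyclic
   relation, sort all letters of [e] but the last, [k]: then [f_e] and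
   [f_(rotr 1 e)] both arise from [E] by moving one letter [k] to one end, and
   the relation becomes the [Y_j]-eigenvalue equation for [j] the last position
   of [k] in [delta], the other letters [k] contributing the powers of [eta]. *)

Require Import Defs.
From mathcomp Require Import all_boot all_order all_algebra.
From mathcomp Require Import fingroup perm finmap reals complex.
From mathcomp Require Import ring zify.
From Stdlib Require Import ClassicalEpsilon.

Set Implicit Arguments.
Unset Strict Implicit.
Unset Printing Implicit Defensive.

Import Order.TTheory GRing.Theory Num.Theory.
Local Open Scope ring_scope.

(** * Laurent polynomials and their values *)

Section Laurent.
Variables (R : realType) (n : nat).
Local Notation C := R[i].
Implicit Types (f g : LP R n) (z : nat -> C) (a b : expo n) (c : C).

Definition mono a z : C := \prod_(k < n) z k ^ a k.

Definition lp_scale c f : LP R n := [fsfun a in finsupp f => c * f a].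
Definition lp_add f g : LP R n :=
  [fsfun a in (finsupp f `|` finsupp g)%fset => f a + g a].
Definition lp_mono a : LP R n := [fsfun b in [fset a]%fset => 1].

Lemma lp_scaleE c f a : lp_scale c f a = c * f a.
Proof. by rewrite fsfunE; case: finsuppP => // _; rewrite mulr0. Qed.

Lemma lp_addE f g a : lp_add f g a = f a + g a.
Proof.
rewrite fsfunE inE; case: finsuppP => //= _; case: finsuppP => //= _.
by rewrite addr0.
Qed.

Lemma lp_monoE a b : lp_mono a b = (b == a)%:R.
Proof. by rewrite fsfunE inE; case: (b == a). Qed.

Lemma lp_scaledP g c f : lp_scaled g c f <-> g = lp_scale c f.
Proof.
by split=> [h|-> a]; rewrite ?lp_scaleE //; apply/fsfunP => a; rewrite lp_scaleE.
Qed.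

(** Padding the support with zero coefficients gives several polynomials a common index set, which
    is what makes evaluation additive. *)
Lemma lev_supp (S : {fset expo n}) f z :
  (finsupp f `<=` S)%fset -> lev f z = \sum_(a <- S) f a * mono a z.
Proof.
move=> sub; rewrite /lev (big_fset_incl _ sub) // => a _ aNf.
by rewrite fsfun_dflt // mul0r.
Qed.

Lemma lev_scale c f z : lev (lp_scale c f) z = c * lev f z.
Proof.
rewrite (@lev_supp (finsupp f)); last first.
  by apply/fsubsetP => a; rewrite !mem_finsupp lp_scaleE mulf_eq0 negb_or => /andP[].
by rewrite mulr_sumr; apply: eq_bigr => a _; rewrite lp_scaleE mulrA.
Qed.

Lemma lev_add f g z : lev (lp_add f g) z = lev f z + lev g z.
Proof.
rewrite (@lev_supp (finsupp f `|` finsupp g)%fset); last first.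
  apply/fsubsetP => a; rewrite inE !mem_finsupp lp_addE.
  by have [->|] := eqVneq (f a) 0; rewrite ?add0r.
rewrite (lev_supp z (fsubsetUl (finsupp f) (finsupp g))).
rewrite (lev_supp z (fsubsetUr (finsupp f) (finsupp g))).
by rewrite -big_split; apply: eq_bigr => a _; rewrite lp_addE mulrDl.
Qed.

Lemma lev_mono a z : lev (lp_mono a) z = mono a z.
Proof.
rewrite (@lev_supp [fset a]%fset); last first.
  apply/fsubsetP => b; rewrite mem_finsupp lp_monoE inE.
  by case: (b == a) => //; rewrite eqxx.
by rewrite big_seq_fset1 lp_monoE eqxx mul1r.
Qed.

Lemma lev0 z : lev (lp0 R n) z = 0.
Proof. by rewrite (@lev_supp fset0) ?big_seq_fset0 // finsupp0. Qed.

Lemma mono_ext a z z' : (forall k, (k < n)%N -> z k = z' k) -> mono a z = mono a z'.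
Proof. by move=> h; apply: eq_bigr => k _; rewrite h. Qed.

(** Points are functions on all of [nat]; this compares composites of swaps and rotations on the
    first [n] coordinates, without functional extensionality. *)
Lemma lev_ext f z z' : (forall k, (k < n)%N -> z k = z' k) -> lev f z = lev f z'.
Proof. by move=> h; apply: eq_bigr => a _; congr (_ * _); exact: mono_ext. Qed.

(** * Functions given by Laurent polynomials: existence of the values of [That] and [omega] *)

Definition laurent (D : (nat -> C) -> Prop) (F : (nat -> C) -> C) :=
  exists g : LP R n, forall z, D z -> lev g z = F z.

Lemma laurent_ext D F G :
  (forall z, D z -> F z = G z) -> laurent D F -> laurent D G.
Proof. by move=> FG [g gF]; exists g => z Dz; rewrite gF ?FG. Qed.

Lemma laurent_sub (D D' : (nat -> C) -> Prop) F :
  (forall z, D' z -> D z) -> laurent D F -> laurent D' F.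
Proof. by move=> DD [g gF]; exists g => z /DD; exact: gF. Qed.

Lemma laurent_add D F G :
  laurent D F -> laurent D G -> laurent D (fun z => F z + G z).
Proof.
by move=> [f fF] [g gG]; exists (lp_add f g) => z Dz; rewrite lev_add fF ?gG.
Qed.

Lemma laurent_scale D c F : laurent D F -> laurent D (fun z => c * F z).
Proof. by move=> [f fF]; exists (lp_scale c f) => z Dz; rewrite lev_scale fF. Qed.

Lemma laurent_sum (I : Type) (s : seq I) D (F : I -> (nat -> C) -> C) :
  (forall i, laurent D (F i)) -> laurent D (fun z => \sum_(i <- s) F i z).
Proof.
move=> LF; elim: s => [|i s [g gS]].
  by exists (lp0 R n) => z _; rewrite lev0 big_nil.
have [f fF] := LF i.
by exists (lp_add f g) => z Dz; rewrite lev_add big_cons fF ?gS.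
Qed.

Lemma laurent_mono a : laurent (torus n) (mono a).
Proof. by exists (lp_mono a) => z _; rewrite lev_mono. Qed.

Lemma mono_add a b z : torus n z ->
  mono a z * mono b z = mono [ffun k => a k + b k] z.
Proof.
move=> tz; rewrite -big_split; apply: eq_bigr => k _.
by rewrite ffunE expfzDr // tz.
Qed.

Lemma laurent_mul F G :
  laurent (torus n) F -> laurent (torus n) G ->
  laurent (torus n) (fun z => F z * G z).
Proof.
move=> [f fF] [g gG].
apply: (@laurent_ext _ (fun z => \sum_(a <- finsupp f) \sum_(b <- finsupp g)
   (f a * g b) * mono [ffun k => a k + b k] z)).
  move=> z tz; rewrite -fF // -gG // mulr_suml; apply: eq_bigr => a _.
  rewrite mulr_sumr; apply: eq_bigr => b _.
  by rewrite -mono_add // !mulrA; congr (_ * _); rewrite -!mulrA; congr (_ * _);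
     rewrite mulrC.
apply: laurent_sum => a; apply: laurent_sum => b.
exact/laurent_scale/laurent_mono.
Qed.

Lemma laurent_const c : laurent (torus n) (fun=> c).
Proof.
apply: (@laurent_ext _ (fun z => c * mono [ffun=> 0] z)).
  by move=> z _; rewrite /mono big1 ?mulr1 // => k _; rewrite ffunE expr0z.
exact/laurent_scale/laurent_mono.
Qed.

Lemma laurent_prod (I : Type) (s : seq I) (P : pred I) (F : I -> (nat -> C) -> C) :
  (forall i, P i -> laurent (torus n) (F i)) ->
  laurent (torus n) (fun z => \prod_(i <- s | P i) F i z).
Proof.
move=> LF; elim: s => [|i s IH].
  by apply: laurent_ext (laurent_const 1) => z _; rewrite big_nil.
case Pi: (P i); last by apply: laurent_ext IH => z _; rewrite big_cons Pi.
by apply: laurent_ext (laurent_mul (LF i Pi) IH) => z _; rewrite big_cons Pi.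
Qed.

Lemma laurent_varX k (m : int) : (k < n)%N -> laurent (torus n) (fun z => z k ^ m).
Proof.
move=> kn; apply: laurent_ext (laurent_mono [ffun l => if val l == k then m else 0]).
move=> z _; rewrite /mono (bigD1 (Ordinal kn)) //= ffunE eqxx big1 ?mulr1 // => l.
by rewrite ffunE -val_eqE /= => /negbTE->; rewrite expr0z.
Qed.

Lemma laurent_zswap i f : (i.+1 < n)%N ->
  laurent (torus n) (fun z => lev f (zswap i z)).
Proof.
move=> lin; apply: laurent_sum => a; apply: laurent_scale.
apply: laurent_prod => k _; rewrite /zswap.
by case: eqP => _; [|case: eqP => _]; apply: laurent_varX => //; lia.
Qed.

Lemma laurent_zrot p f : laurent (torus n) (fun z => lev f (zrot n p z)).
Proof.
apply: laurent_sum => a; apply: laurent_scale.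
apply: laurent_prod => k _; rewrite /zrot.
have kn := ltn_ord k.
case: eqP => _; last by apply: laurent_varX; lia.
apply: (@laurent_ext _ (fun z => (p%:C)%C ^ a k * z n.-1 ^ a k)).
  by move=> z _; rewrite -expfzMl.
by apply/laurent_scale/laurent_varX; lia.
Qed.

Definition offdiag i z := torus n z /\ z i != z i.+1.

(** With $x=z_i$ and $y=z_{i+1}$, the denominator is $(x-y)/y$ and $x-y$ divides $x^m-y^m$, so the
    quotient is $y\sum_j x^{m-1-j}y^j$. *)
Lemma laurent_quot_nat i m : (i.+1 < n)%N ->
  laurent (offdiag i)
    (fun z => (z i ^+ m - z i.+1 ^+ m) / (z i / z i.+1 - 1)).
Proof.
move=> lin.
apply: (@laurent_ext _ (fun z => z i.+1 *
   \sum_(j <- index_enum 'I_m) z i ^+ (m.-1 - j) * z i.+1 ^+ j)).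
  move=> z [tz zz]; rewrite subrXX.
  have h1 : z i.+1 != 0 by apply: tz.
  have h2 : z i - z i.+1 != 0 by rewrite subr_eq0.
  by set S := \sum_(_ <- _) _; field; rewrite h1 mulN1r.
apply: (@laurent_sub (torus n)) => [z []//|].
apply: laurent_mul; first exact: (@laurent_varX _ 1).
apply: laurent_sum => j.
by apply: laurent_mul; apply: (@laurent_varX _ (Posz _)); lia.
Qed.

Lemma mono_split i a z (lin : (i.+1 < n)%N) (li := ltnW lin) :
  mono a z = z i ^ a (Ordinal li) * z i.+1 ^ a (Ordinal lin) *
    \prod_(k < n | (val k != i) && (val k != i.+1)) z k ^ a k.
Proof.
rewrite /mono (bigD1 (Ordinal li)) //= -mulrA; congr (_ * _).
rewrite (bigD1 (Ordinal lin)) /=; last by rewrite -val_eqE /=; lia.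
by congr (_ * _); apply: eq_bigl => k; rewrite -!val_eqE.
Qed.

Lemma mono_zswap_split i a z (lin : (i.+1 < n)%N) (li := ltnW lin) :
  mono a (zswap i z) = z i.+1 ^ a (Ordinal li) * z i ^ a (Ordinal lin) *
    \prod_(k < n | (val k != i) && (val k != i.+1)) z k ^ a k.
Proof.
rewrite (mono_split _ _ lin) /zswap !eqxx; have -> : (i.+1 == i) = false by lia.
by congr (_ * _); apply: eq_bigr => k /andP[/negbTE-> /negbTE->].
Qed.

(** Pulling out the common power of $z_i z_{i+1}$, with the smaller of the two exponents, leaves a
    difference of $m$-th powers up to sign, where $m$ is the gap between the exponents. *)
Lemma laurent_quot_mono i a : (i.+1 < n)%N ->
  laurent (offdiag i)
    (fun z => (mono a (zswap i z) - mono a z) / (z i / z i.+1 - 1)).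
Proof.
move=> lin; have li := ltnW lin.
set x := a (Ordinal (ltnW lin)); set y := a (Ordinal lin).
pose r z := \prod_(k < n | (val k != i) && (val k != i.+1)) z k ^ a k.
have Lr : laurent (torus n) r.
  by apply: laurent_prod => k _; exact: laurent_varX.
have Lm (u : int) : laurent (torus n) (fun z => z i ^ u * z i.+1 ^ u * r z).
  by do 2![apply: laurent_mul => //]; exact: laurent_varX.
pose m := `|y - x|%N.
have [q qE] := laurent_quot_nat m lin.
have Lq : laurent (torus n) (lev q) by exists q.
have [yx|yx] := lerP x y.
  apply: laurent_ext (laurent_sub _ (laurent_mul (Lm x) Lq)) => [z Dz|z []//].
  rewrite qE // (mono_zswap_split _ _ lin) (mono_split _ _ lin) -/x -/y -/(r z).
  have [tz _] := Dz; have -> : y = x + m by rewrite /m; lia.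
  by rewrite !expfzDr ?tz // -!exprnP; ring.
apply: laurent_ext (laurent_scale (-1) (laurent_sub _ (laurent_mul (Lm y) Lq)))
   => [z Dz|z []//].
rewrite qE // (mono_zswap_split _ _ lin) (mono_split _ _ lin) -/x -/y -/(r z).
have [tz _] := Dz; have -> : x = y + m by rewrite /m; lia.
by rewrite !expfzDr ?tz // -!exprnP; ring.
Qed.

(** The divided difference is linear in [f], so it is enough to treat each monomial. This is the
    existence needed for the choice in [That]. *)
Lemma laurent_That ts i f : (i.+1 < n)%N ->
  laurent (offdiag i) (fun z => ts * lev f (zswap i z)
    + (ts - ts^-1) / (z i / z i.+1 - 1) * (lev f (zswap i z) - lev f z)).
Proof.
move=> lin; apply: laurent_add.
  by apply/laurent_scale/(laurent_sub _ (laurent_zswap f lin)) => z [].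
apply: (@laurent_ext _ (fun z => (ts - ts^-1) * \sum_(a <- finsupp f)
   f a * ((mono a (zswap i z) - mono a z) / (z i / z i.+1 - 1)))).
  move=> z _; rewrite /lev -sumrB !mulr_sumr; apply: eq_bigr => a _.
  by rewrite -/(mono a z) -/(mono a (zswap i z)); ring.
by apply/laurent_scale/laurent_sum => a; exact/laurent_scale/laurent_quot_mono.
Qed.

(** Distinctness is asked of all pairs, so that swaps preserve it and no denominator vanishes in a
    composite of several [That]. *)
Definition generic z :=
  torus n z /\ forall k l, (k < l)%N -> (l < n)%N -> z k != z l.

Lemma generic_offdiag i z : (i.+1 < n)%N -> generic z -> offdiag i z.
Proof. by move=> lin [tz gz]; split=> //; apply: gz. Qed.

End Laurent.

(** * A Laurent polynomial is determined by its values at generic points *)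

Lemma horner_neq0_nat (F : idomainType) (P : {poly F}) (x : nat -> F) :
  injective x -> P != 0 -> exists m, P.[x m] != 0.
Proof.
move=> injx Pn0; pose s := map x (iota 0 (size P)).
(* A nonzero polynomial has fewer than [size P] roots, so the [size P] distinct sample points cannot
   all be roots. *)
have : ~~ all (root P) s.
  apply/negP => /(max_poly_roots Pn0); rewrite map_inj_uniq ?iota_uniq //.
  by move/(_ isT); rewrite size_map size_iota ltnn.
by case/allPn => _ /mapP[m _ ->]; exists m.
Qed.

Section Kronecker.
Variables (R : realType) (n : nat).
Local Notation C := R[i].
Implicit Types (f g : LP R n) (a b : expo n).

(** The exponent of $x$ in the monomial with exponents [a] after substituting $z_k = x^{M^k}$. *)
Definition kron (M : nat) a : int := \sum_(k < n) a k * M%:Z ^+ k.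

Definition kron_poly a : {poly int} := \sum_(k < n) a k *: 'X^k.

Lemma kron_polyE M a : (kron_poly a).[M%:Z] = kron M a.
Proof.
by rewrite /kron_poly horner_sum; apply: eq_bigr => k _; rewrite hornerZ hornerXn.
Qed.

Lemma kron_poly_inj : injective kron_poly.
Proof.
move=> a b ab; apply/ffunP => k.
have coefk c : (kron_poly c)`_k = c k.
  rewrite coef_sum (bigD1 k) //= coefZ coefXn eqxx mulr1 big1 ?addr0 // => l lk.
  by rewrite coefZ coefXn val_eqE eq_sym (negbTE lk) mulr0.
by rewrite -!coefk ab.
Qed.

(** Distinct exponent vectors give distinct integer polynomials in $M$; any $M$ that is not a root
    of the product of their pairwise differences works. The values [m.+2] are sampled to ensure
    $M>1$. *)
Lemma kron_inj (S : seq (expo n)) :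
  exists2 M, (1 < M)%N & {in S &, injective (kron M)}.
Proof.
pose P := \prod_(a <- S) \prod_(b <- S | a != b) (kron_poly a - kron_poly b).
have Pn0 : P != 0.
  rewrite prodf_seq_neq0; apply/allP => a _ /=.
  rewrite prodf_seq_neq0; apply/allP => b _; apply/implyP => ab.
  by rewrite subr_eq0; apply: contra_neq ab => /kron_poly_inj.
have [|m Pm] := @horner_neq0_nat _ P (fun m => m.+2%:Z) _ Pn0.
  by move=> u v []; lia.
exists m.+2 => // a b aS bS kab; apply/eqP; apply: contraNT Pm => ab.
rewrite horner_prod prodf_seq_eq0; apply/hasP; exists a => //=.
rewrite horner_prod prodf_seq_eq0; apply/hasP; exists b => //=.
by rewrite ab hornerD hornerN !kron_polyE kab subrr eqxx.
Qed.

(* Kronecker substitution [z_k = x ^ (M ^ k)] turns a Laurent polynomial into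
   a univariate one without merging monomials. *)
Lemma lev_eq0 f : (forall z, generic n z -> lev f z = 0) -> forall a, f a = 0.
Proof.
move=> f0 a0; have [/eqP//|fa0] := boolP (f a0 == 0).
have [M M1 kinj] := kron_inj (finsupp f).
(* A shift large enough to make every exponent nonnegative, so that [Q] is a genuine polynomial. *)
pose K := (\sum_(a <- finsupp f) `|kron M a|)%N.
have Kpos a : a \in finsupp f -> 0 <= kron M a + K%:Z.
  by move=> aS; rewrite /K (big_fsetD1 a) //=; lia.
pose Q : {poly C} := \sum_(a <- finsupp f) f a *: 'X^`|kron M a + K%:Z|.
have Q0 : Q != 0.
  apply/eqP => Q0; case/negP: (fa0); apply/eqP.
  have <- : Q`_`|kron M a0 + K%:Z| = f a0; last by rewrite Q0 coef0.
  have a0S : a0 \in finsupp f by rewrite mem_finsupp.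
  rewrite coef_sum (big_fsetD1 a0) //= coefZ coefXn eqxx mulr1 big_seq big1 ?addr0 //.
  move=> a; rewrite in_fsetD1 => /andP[aa0 aS]; rewrite coefZ coefXn.
  case: eqP => [h|]; last by rewrite mulr0.
  have := Kpos a aS; have := Kpos a0 a0S => ? ?.
  by case/eqP: aa0; apply: kinj => //; lia.
(* The powers $2^{m+1}$ are nonzero and not roots of unity, so the coordinates $x^{M^k}$ are nonzero
   and pairwise distinct. *)
have pow2_inj : injective (fun m => 2%:R ^+ m.+1 : C).
  move=> u v /eqP; rewrite -!natrX eqr_nat eqn_exp2l // => /eqP[].
  by move=> ->.
have [m /negP[]] := horner_neq0_nat pow2_inj Q0.
set x : C := 2%:R ^+ m.+1.
have x0 : x != 0 by rewrite expf_neq0 // pnatr_eq0.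
have gz : generic n (fun k => x ^+ (M ^ k)).
  split=> [k _|k l kl _]; first exact: expf_neq0.
  rewrite -!exprM -natrX; apply/eqP => /eqP.
  rewrite -natrX eqr_nat eqn_exp2l // eqn_pmul2l // eqn_exp2l //; lia.
have := f0 _ gz; rewrite /lev => fz.
(* By the choice of the shift, $Q(x)$ is $x^K$ times the value of [f] at the substituted point,
   which is zero. *)
apply/eqP; transitivity (x ^ K%:Z * 0); last by rewrite mulr0.
rewrite -{}fz mulr_sumr horner_sum big_seq [RHS]big_seq; apply: eq_bigr => a aS.
rewrite hornerZ hornerXn mulrCA; congr (_ * _).
have -> : \prod_(k < n) (x ^+ (M ^ k)) ^ a k = x ^ kron M a.
  rewrite /kron; elim/big_rec2: _ => [|k u v _ ->]; first by rewrite expr0z.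
  rewrite expfzDr //; congr (_ * _).
  by rewrite exprnP exprz_exp mulrC -natz natrX natz.
by rewrite -expfzDr // [x ^+ _]exprnP gez0_abs ?Kpos // addrC.
Qed.

Lemma lev_inj f g : (forall z, generic n z -> lev f z = lev g z) -> f = g.
Proof.
move=> fg; apply/fsfunP => a.
have h : forall b, lp_add f (lp_scale (-1) g) b = 0.
  by apply: lev_eq0 => z gz; rewrite lev_add lev_scale fg // mulN1r subrr.
by move/eqP: (h a); rewrite lp_addE lp_scaleE mulN1r subr_eq0 => /eqP.
Qed.

End Kronecker.


(** * Hecke operators *)

Section Hecke.
Variables (R : realType) (n : nat) (ts : R[i]).
Hypothesis ts0 : ts != 0.
Local Notation C := R[i].
Local Notation T := (@That R n ts).
Implicit Types (f g : LP R n) (z : nat -> C) (c : C).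

(** With this coefficient $\widehat T_i = (t^{1/2}+\kappa)\tau_i - \kappa$, the form used in all
    evaluations. *)
Definition kappa i z : C := (ts - ts^-1) / (z i / z i.+1 - 1).

Lemma lp_suchP (P : LP R n -> Prop) : (exists f, P f) -> P (lp_such P).
Proof. exact: epsilon_spec. Qed.

Lemma lev_That_offdiag i f z : (i.+1 < n)%N -> offdiag n i z ->
  lev (T i f) z = (ts + kappa i z) * lev f (zswap i z) - kappa i z * lev f z.
Proof.
move=> lin Dz; have [tz zz] := Dz.
have ex : exists g : LP R n, forall z, torus n z -> z i != z i.+1 ->
    lev g z = ts * lev f (zswap i z)
      + (ts - ts^-1) / (z i / z i.+1 - 1) * (lev f (zswap i z) - lev f z).
  by have [g gE] := laurent_That ts f lin; exists g => y ty yy; apply: gE.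
rewrite [LHS](lp_suchP ex) // -/(kappa i z).
by move: (kappa i z) (lev f _) (lev f _) => k x y; ring.
Qed.

Lemma lev_That i f z : (i.+1 < n)%N -> generic n z ->
  lev (T i f) z = (ts + kappa i z) * lev f (zswap i z) - kappa i z * lev f z.
Proof. by move=> lin gz; apply/lev_That_offdiag/generic_offdiag. Qed.

Lemma lev_omega (p : R) f z : torus n z -> lev (omega p f) z = lev f (zrot n p z).
Proof.
move=> tz; have [g gE] := laurent_zrot p f.
have := @lp_suchP (fun g => forall z, torus n z -> lev g z = lev f (zrot n p z)).
by apply=> //; exists g.
Qed.

Lemma generic_neq z k l : generic n z -> k != l -> (k < n)%N -> (l < n)%N ->
  z k != z l.
Proof.
move=> [_ gz]; rewrite neq_ltn => /orP[kl|lk] kn ln; first exact: gz.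
by rewrite eq_sym; apply: gz.
Qed.

Lemma generic_zswap i z : (i.+1 < n)%N -> generic n z -> generic n (zswap i z).
Proof.
move=> lin gz; have [tz _] := gz; split=> [k kn|k l kl ln].
  by rewrite /zswap; case: ifP => _; [|case: ifP => _]; apply: tz; lia.
rewrite /zswap; do ?[case: ifP => ? //=]; apply: generic_neq => //; lia.
Qed.

Lemma That_scale i c f : (i.+1 < n)%N -> T i (lp_scale c f) = lp_scale c (T i f).
Proof.
move=> lin; apply: lev_inj => z gz.
rewrite !(lev_scale, lev_That) //.
by move: (kappa i z) (lev f _) (lev f _) => k x y; ring.
Qed.

Lemma omega_scale (p : R) c f : omega p (lp_scale c f) = lp_scale c (omega p f).
Proof.
by apply: lev_inj => z [tz _]; rewrite !(lev_scale, lev_omega).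
Qed.

Lemma zswapK i z k : zswap i (zswap i z) k = z k.
Proof.
rewrite /zswap !eqxx; case: eqP => [->|ki]; last by case: eqP => [->|].
by have -> : (i.+1 == i) = false by lia.
Qed.

Lemma zswap_at i z : zswap i z i = z i.+1. Proof. by rewrite /zswap eqxx. Qed.

Lemma zswap_atS i z : zswap i z i.+1 = z i.
Proof. by rewrite /zswap eqxx; have -> : (i.+1 == i) = false by lia. Qed.

Lemma zswap_out i z k : k != i -> k != i.+1 -> zswap i z k = z k.
Proof. by rewrite /zswap => /negbTE-> /negbTE->. Qed.

(** The Hecke relation $(\widehat T_i - t^{1/2})(\widehat T_i + t^{-1/2}) = 0$. At a generic point
    it is a rational identity in $z_i, z_{i+1}$, linear in the values of [f] at [z] and at the
    swapped point. *)
Lemma That_quadratic i f : (i.+1 < n)%N ->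
  T i (T i f) = lp_add (lp_scale (ts - ts^-1) (T i f)) f.
Proof.
move=> lin; apply: lev_inj => z gz; have gz' := generic_zswap lin gz.
rewrite lev_add lev_scale !lev_That //.
rewrite (@lev_ext _ _ f (zswap i (zswap i z)) z); last by move=> k _; rewrite zswapK.
have := generic_neq gz (_ : i != i.+1) (ltnW lin) lin; rewrite neq_ltn ltnSn => /(_ isT).
have [tz _] := gz; have := tz _ lin; have := tz _ (ltnW lin).
rewrite /kappa zswap_at zswap_atS.
move: (lev f z) (lev f _) (z i) (z i.+1) => a b u v u0 v0 uv.
by field; rewrite !mulN1r !subr_eq0 (eq_sym v u) ts0 u0 v0 uv.
Qed.

Lemma That_inj i : (i.+1 < n)%N -> injective (T i).
Proof.
move=> lin f g fg; have := congr1 (T i) fg; rewrite !That_quadratic // fg.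
move=> h; apply/fsfunP => a; have := congr1 (fun k : LP R n => k a) h.
by rewrite !lp_addE => /addrI.
Qed.

(** By the quadratic relation the inverse is $\widehat T_i - (t^{1/2}-t^{-1/2})$; this witness makes
    the choice in [Tinv] meaningful. *)
Lemma ThatK i f : (i.+1 < n)%N ->
  T i (lp_add (T i f) (lp_scale (- (ts - ts^-1)) f)) = f.
Proof.
move=> lin; apply: lev_inj => z gz.
have Q := congr1 (fun h => lev h z) (That_quadratic f lin).
rewrite /= lev_add lev_scale lev_That // in Q.
rewrite lev_That // !lev_add !lev_scale.
transitivity ((ts + kappa i z) * lev (T i f) (zswap i z)
    - kappa i z * lev (T i f) z - (ts - ts^-1) * lev (T i f) z).
  rewrite [in X in _ = _ - X]lev_That //.
  move: (lev _ _) (lev _ _) (lev f _) (lev f _) (kappa i z) (ts - ts^-1).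
  by move=> k x y u v d; ring.
by rewrite Q addrC addKr.
Qed.

Lemma TinvK i f : (i.+1 < n)%N -> T i (Tinv ts i f) = f.
Proof.
move=> lin; apply: (@lp_suchP (fun g => T i g = f)).
by eexists; apply: ThatK.
Qed.

Lemma ThatTinv i f : (i.+1 < n)%N -> Tinv ts i (T i f) = f.
Proof. by move=> lin; apply: (That_inj lin); rewrite TinvK. Qed.

Lemma Tinv_scale i c f : (i.+1 < n)%N ->
  Tinv ts i (lp_scale c f) = lp_scale c (Tinv ts i f).
Proof. by move=> lin; apply: (That_inj lin); rewrite That_scale // !TinvK. Qed.

Lemma That_comm i j f : (i.+1 < j)%N -> (j.+1 < n)%N ->
  T i (T j f) = T j (T i f).
Proof.
move=> ij jn; have lin : (i.+1 < n)%N by lia.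
apply: lev_inj => z gz.
have gi := generic_zswap lin gz; have gj := generic_zswap jn gz.
rewrite !lev_That // /kappa !(@zswap_out i z) ?(@zswap_out j z) //; try lia.
rewrite (@lev_ext _ _ f (zswap j (zswap i z)) (zswap i (zswap j z))).
  move: (lev f _) (lev f _) (lev f _) (lev f _) (_ / _) (_ / _).
  by move=> x1 x2 x3 x4 k1 k2; ring.
move=> k _; rewrite /zswap; do ?[case: ifP => ? //=]; try lia; congr (z _); lia.
Qed.

Lemma That_braid i f : (i.+2 < n)%N ->
  T i (T i.+1 (T i f)) = T i.+1 (T i (T i.+1 f)).
Proof.
move=> ln; have lin : (i.+1 < n)%N by lia.
apply: lev_inj => z gz.
have g1 := generic_zswap lin gz; have g2 := generic_zswap ln gz.
have g12 := generic_zswap ln g1; have g21 := generic_zswap lin g2.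
rewrite !lev_That // /kappa.
rewrite !(zswap_at, zswap_atS).
have z1 (y : nat -> C) : zswap i y i.+2 = y i.+2 by apply: zswap_out; lia.
have z2 (y : nat -> C) : zswap i.+1 y i = y i by apply: zswap_out; lia.
rewrite !(z1, z2, zswap_at, zswap_atS).
(* The two reduced expressions of the longest element of $S_3$ give the same point, and repeated
   swaps cancel. What remains is a rational identity, linear in the six values of [f] on the
   orbit. *)
rewrite (@lev_ext _ _ f (zswap i (zswap i.+1 (zswap i z)))
    (zswap i.+1 (zswap i (zswap i.+1 z)))); last first.
  move=> k _; rewrite /zswap; do ?[case: ifP => ? //=]; try lia; congr (z _); lia.
rewrite (@lev_ext _ _ f (zswap i (zswap i z)) z); last by move=> k _; rewrite zswapK.
rewrite (@lev_ext _ _ f (zswap i.+1 (zswap i.+1 z)) z); last by move=> k _; rewrite zswapK.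
have [tz _] := gz; have := tz _ ln; have := tz _ lin; have := tz _ (ltnW lin).
have : z i != z i.+1 by apply: generic_neq => //; lia.
have : z i.+1 != z i.+2 by apply: generic_neq => //; lia.
have : z i != z i.+2 by apply: generic_neq => //; lia.
move: (lev f _) (lev f _) (lev f _) (lev f _) (lev f _) (lev f _).
move: (z i) (z i.+1) (z i.+2) => u v w a1 a2 a3 a4 a5 a6 uw vw uv u0 v0 w0.
field; rewrite !mulN1r !subr_eq0 (eq_sym w v) (eq_sym v u).
by rewrite ts0 u0 v0 w0 uv uw vw.
Qed.

(** Rotation puts $z_i, z_{i+1}$ at positions $i+1, i+2$, so [kappa] at the rotated point is
    unchanged and the swaps correspond. *)
Lemma omega_That (p : R) i f : p != 0 -> (i.+2 < n)%N ->
  omega p (T i.+1 f) = T i (omega p f).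
Proof.
move=> p0 ln; have lin : (i.+1 < n)%N by lia.
apply: lev_inj => z gz; have [tz gz'] := gz; have [tz' _] := generic_zswap lin gz.
(* The rotated point may fail to be generic, because $p z_{n-1}$ can equal another coordinate; hence
   the formula off a single diagonal is used here. *)
have Dz : offdiag n i.+1 (zrot n p z).
  split; last exact: gz'.
  move=> k kn; rewrite /zrot; case: ifP => _; last by apply: tz; lia.
  by rewrite mulf_neq0 ?tz ?prednK ?fmorph_eq0 //; lia.
rewrite lev_That // !lev_omega // lev_That_offdiag //.
rewrite (@lev_ext _ _ f (zswap i.+1 (zrot n p z)) (zrot n p (zswap i z))) // => k kn.
rewrite /zswap /zrot /=; do ?[case: ifP => ? //=]; try lia; congr (z _); lia.
Qed.

End Hecke.


(** * Sorting words *)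

Section Sorting.
Local Open Scope nat_scope.
Implicit Types (e s t u v : seq nat) (i j k : nat).

(** Only strict inversions count, so equal letters are never exchanged; for a sequence with
    repetitions this is the length of its shortest sorting permutation. *)
Fixpoint inversions s :=
  if s is x :: s' then count (fun y => y < x) s' + inversions s' else 0.

Lemma sswap_cat s a b t : sswap (size s) (s ++ a :: b :: t) = s ++ b :: a :: t.
Proof. by elim: s => // x s IH; rewrite /= -IH. Qed.

Lemma sswap_split e i : i.+1 < size e -> exists s t,
  [/\ size s = i, e = s ++ nth 0 e i :: nth 0 e i.+1 :: t
    & sswap i e = s ++ nth 0 e i.+1 :: nth 0 e i :: t].
Proof.
move=> ie; exists (take i e), (drop i.+2 e).
have sz : size (take i e) = i by rewrite size_take; case: ifP; lia.
have E : e = take i e ++ nth 0 e i :: nth 0 e i.+1 :: drop i.+2 e.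
  by rewrite -(drop_nth 0) // -(drop_nth 0) ?cat_take_drop // ltnW.
by split=> //; rewrite [in LHS]E -[X in sswap X _]sz sswap_cat.
Qed.

Lemma nth_sswap e i k : nth 0 (sswap i e) k =
  if k == i.+1 then nth 0 e i else if k == i then nth 0 e i.+1 else nth 0 e k.
Proof. by rewrite /sswap !nth_set_nth /= nth_set_nth. Qed.

Lemma size_sswap e i : i.+1 < size e -> size (sswap i e) = size e.
Proof. by move=> ie; rewrite /sswap !size_set_nth; lia. Qed.

Lemma eq_seq_nth s t : size s = size t ->
  (forall k, nth 0 s k = nth 0 t k) -> s = t.
Proof. by move=> st h; apply: (@eq_from_nth _ 0). Qed.

Lemma sswapK e i : i.+1 < size e -> sswap i (sswap i e) = e.
Proof.
move=> ie; apply: eq_seq_nth => [|k]; rewrite ?size_sswap // !nth_sswap !eqxx.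
by do ?[case: ifP => ? //=]; try lia; congr nth; lia.
Qed.

Lemma sswap_id e i : i.+1 < size e -> nth 0 e i = nth 0 e i.+1 -> sswap i e = e.
Proof.
move=> ie ee; apply: eq_seq_nth => [|k]; rewrite ?size_sswap // nth_sswap.
by do ?[case: eqP => [->|] //].
Qed.

Lemma sswap_comm e i j : i.+1 < j -> j.+1 < size e ->
  sswap i (sswap j e) = sswap j (sswap i e).
Proof.
move=> ij je; apply: eq_seq_nth => [|k]; rewrite ?size_sswap //; try lia.
by rewrite !nth_sswap; do ?[case: ifP => ? //=]; lia.
Qed.

Lemma sswap_braid e i : i.+2 < size e ->
  sswap i (sswap i.+1 (sswap i e)) = sswap i.+1 (sswap i (sswap i.+1 e)).
Proof.
move=> ie; apply: eq_seq_nth => [|k]; rewrite ?size_sswap //; try lia.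
by rewrite !nth_sswap; do ?[case: ifP => ? //=]; try lia; congr nth; lia.
Qed.

Lemma perm_cons2 (a b : nat) t : perm_eq (a :: b :: t) (b :: a :: t).
Proof. exact/permPl/(perm_catCA [:: a] [:: b] t). Qed.

Lemma perm_sswap e i : i.+1 < size e -> perm_eql (sswap i e) e.
Proof.
move=> ie; apply/permPl; have [s [t [_ E ->]]] := sswap_split ie.
by rewrite [X in perm_eq _ X]E perm_cat2l perm_cons2.
Qed.

(** Pairs inside [s], and pairs with one letter in [s], are insensitive to reordering the tail. The
    additive form avoids truncated subtraction. *)
Lemma inversions_cat_perm s t t' : perm_eq t t' ->
  inversions (s ++ t) + inversions t' = inversions (s ++ t') + inversions t.
Proof.
move=> tt'; elim: s => [|x s IH] /=; first exact: addnC.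
by rewrite -!addnA IH !count_cat (seq.permP tt').
Qed.

Lemma inversions_descent e i : i.+1 < size e -> nth 0 e i.+1 < nth 0 e i ->
  inversions e = (inversions (sswap i e)).+1.
Proof.
move=> ie; have [s [t [_ E ->]]] := sswap_split ie.
rewrite [X in inversions X = _]E.
move: (nth 0 e i) (nth 0 e i.+1) => a b ba.
have /= := inversions_cat_perm s (perm_cons2 a b t).
by rewrite ba ltnNge (ltnW ba) /=; lia.
Qed.

Lemma inversions_sswap_ge e i : i.+1 < size e ->
  inversions e <= (nth 0 e i.+1 < nth 0 e i) + inversions (sswap i e).
Proof.
move=> ie; case: ltngtP => [de|ae|ee].
- by rewrite (inversions_descent ie de).
- rewrite [X in _ <= X](@inversions_descent (sswap i e) i) ?size_sswap //.
    by rewrite sswapK //; lia.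
  by rewrite !nth_sswap !eqxx; case: ifP; lia.
- by rewrite sswap_id.
Qed.

Lemma sorted_inversions s : sorted leq s = (inversions s == 0).
Proof.
elim: s => //= x s IH; rewrite (path_sortedE leq_trans) IH addn_eq0; congr (_ && _).
rewrite -[RHS]negbK -lt0n -has_count -all_predC; apply: eq_all => y /=.
by rewrite -leqNgt.
Qed.

Lemma descent_exists s : ~~ sorted leq s ->
  exists2 i, i.+1 < size s & nth 0 s i.+1 < nth 0 s i.
Proof.
elim: s => //= x [|y s] //= IH; rewrite negb_and -ltnNge => /orP[yx|ns].
  by exists 0.
by have [i ? ?] := IH ns; exists i.+1.
Qed.

(** Since [foldr] applies the last letter of [u] first, words are peeled from the right. The length
    condition makes every swap a strict descent. *)
Definition sorting_word u e :=
  [&& all (fun i => i.+1 < size e) u, size u == inversions e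
    & sorted leq (foldr sswap e u)].

Lemma size_foldr_sswap e u : all (fun i => i.+1 < size e) u ->
  size (foldr sswap e u) = size e.
Proof. by elim: u => //= i u IH /andP[ie /IH eu]; rewrite size_sswap eu. Qed.

Lemma inversions_foldr_sswap e u : all (fun i => i.+1 < size e) u ->
  inversions e <= size u + inversions (foldr sswap e u).
Proof.
elim: u => //= i u IH /andP[ie au]; apply: (leq_trans (IH au)).
have iu : i.+1 < size (foldr sswap e u) by rewrite size_foldr_sswap.
by apply: leq_trans (leq_add (leqnn _) (inversions_sswap_ge iu)) _; case: ltnP; lia.
Qed.

(** A swap removes at most one inversion, and does so only at a strict descent; a word of length
    [inversions e] therefore cannot waste its first swap. *)
Lemma sorting_word_rcons u i e :
  sorting_word (rcons u i) e =
  [&& i.+1 < size e, nth 0 e i.+1 < nth 0 e i & sorting_word u (sswap i e)].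
Proof.
rewrite /sorting_word all_rcons foldr_rcons size_rcons.
have [ie /=|//] := boolP (i.+1 < size e).
rewrite size_sswap //; have [au /=|_] := boolP (all _ u); last by rewrite andbF.
have au' : all (fun k => k.+1 < size (sswap i e)) u by rewrite size_sswap.
have [|_] := boolP (sorted _ _); last by rewrite !andbF.
rewrite sorted_inversions => /eqP iu; have := inversions_foldr_sswap au'.
rewrite iu addn0 !andbT; have := inversions_sswap_ge ie.
have := @inversions_descent e i ie; case: ltnP => /= [_ /(_ isT) -> //|_ _].
by move=> h1 h2; apply/eqP; lia.
Qed.

Lemma sorting_word_exists e : exists u, sorting_word u e.
Proof.
move: {2}(inversions e) (leqnn (inversions e)) => m.
elim: m e => [|m IH] e em.
  exists [::]; rewrite /sorting_word /= eq_sym sorted_inversions.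
  by move: em; rewrite leqn0 => /eqP->.
have [se|/descent_exists[i ie de]] := boolP (sorted leq e).
  exists [::]; rewrite /sorting_word /= eq_sym se.
  by rewrite -sorted_inversions se.
have := inversions_descent ie de => E; have [|u su] := IH (sswap i e); first by lia.
by exists (rcons u i); rewrite sorting_word_rcons ie de.
Qed.

(* Matsumoto's theorem for sorting words: two first swaps can be completed to
   a common sorting word by a commutation or a braid move. *)
Lemma sorting_word_coherence (X : Type) (S : nat -> X -> X) n (x : X) :
  (forall i j y, i.+1 < j -> j.+1 < n -> S i (S j y) = S j (S i y)) ->
  (forall i y, i.+2 < n -> S i (S i.+1 (S i y)) = S i.+1 (S i (S i.+1 y))) ->
  forall e u v, size e = n -> sorting_word u e -> sorting_word v e ->
  foldl (fun y i => S i y) x u = foldl (fun y i => S i y) x v.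
Proof.
move=> comm braid e u; move: {2}(size u) (erefl (size u)) => m.
elim: m e u => [|m IH] e u um v en su sv.
  move/size0nil: um su => -> /and3P[_ /eqP iv _]; case/and3P: sv => _ /eqP.
  by rewrite -iv => /size0nil->.
have vm : size v = m.+1.
  by case/and3P: su => _ /eqP E _; case/and3P: sv => _ /eqP-> _; rewrite -E.
case/lastP: u um su => // u i; rewrite size_rcons => -[um] su.
case/lastP: v vm sv => // v j; rewrite size_rcons => -[vm] sv.
wlog ij : i j u v um vm su sv / i <= j.
  move=> H; have [ij|/ltnW ij] := leqP i j; first exact: H.
  by symmetry; apply: H.
move: su sv; rewrite !sorting_word_rcons => /and3P[ie di su] /and3P[je dj sv].
rewrite !foldl_rcons.
move: ij; rewrite leq_eqVlt => /orP[/eqP ij|].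
  by subst j; congr (S i _); apply: IH um _ _ su sv; rewrite size_sswap.
rewrite leq_eqVlt => /orP[/eqP ij|ij].
  subst j.
  (* Both [i] and [i.+1] are descents, so three consecutive letters strictly decrease. Reversing
     them either way gives the same sequence, and its sorting word [y] completes both first
     swaps. *)
  have [y sy] := sorting_word_exists (sswap i (sswap i.+1 (sswap i e))).
  have sz1 : size (sswap i e) = size e by rewrite size_sswap.
  have sz2 : size (sswap i.+1 e) = size e by rewrite size_sswap.
  have -> : foldl (fun y i => S i y) x u =
      foldl (fun y i => S i y) x (rcons (rcons y i) i.+1).
    apply: IH um _ _ su _; rewrite ?sz1 // !sorting_word_rcons sy.
    rewrite ?size_sswap ?sz1 // !nth_sswap !eqxx.
    by do ?[case: ifP => ? //=]; lia.
  have -> : foldl (fun y i => S i y) x v =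
      foldl (fun y i => S i y) x (rcons (rcons y i.+1) i).
    apply: IH vm _ _ sv _; rewrite ?sz2 // !sorting_word_rcons -sswap_braid // sy.
    rewrite ?size_sswap ?sz2 // !nth_sswap !eqxx.
    by do ?[case: ifP => ? //=]; lia.
  by rewrite !foldl_rcons braid // -en.
(* The two descents are disjoint, so each survives the other swap, and one word [y] completes both
   orders. *)
have [y sy] := sorting_word_exists (sswap j (sswap i e)).
have -> : foldl (fun y i => S i y) x u = foldl (fun y i => S i y) x (rcons y j).
  apply: IH um _ _ su _; rewrite ?size_sswap // sorting_word_rcons sy.
  by rewrite size_sswap // je !nth_sswap; do ?[case: ifP => ? //=]; lia.
have -> : foldl (fun y i => S i y) x v = foldl (fun y i => S i y) x (rcons y i).
  apply: IH vm _ _ sv _; rewrite ?size_sswap // sorting_word_rcons sswap_comm // sy.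
  by rewrite size_sswap // ie !nth_sswap; do ?[case: ifP => ? //=]; lia.
by rewrite !foldl_rcons comm // -en.
Qed.

End Sorting.


(** * Reduced words of permutations *)

Section Permutations.
Local Open Scope nat_scope.
Variable n : nat.
Implicit Types (w : {perm 'I_n}) (e s t u v : seq nat) (k : 'I_n).

Local Notation in_range := (all (fun i => i.+1 < n)).

Lemma val_sw i k : i.+1 < n -> val (sw i k) =
  if val k == i then i.+1 else if val k == i.+1 then i else val k.
Proof.
move=> ie; rewrite val_insubd; have := ltn_ord k.
case: (val k =P i) => ?; first by rewrite ie.
case: (val k =P i.+1) => ?; first by rewrite (ltnW ie).
by move->.
Qed.

Lemma sw_inj i : i.+1 < n -> injective (@sw n i).
Proof.
move=> ie k l /(congr1 val); rewrite !val_sw // => h; apply: val_inj.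
by move: h; do ?[case: ifP => /= ?]; lia.
Qed.

Lemma nth_sswap_sw i e k : i.+1 < n -> nth 0 (sswap i e) (sw i k) = nth 0 e k.
Proof.
move=> ie; rewrite nth_sswap val_sw //.
case: (val k =P i) => [->|ki]; first by rewrite eqxx.
case: (val k =P i.+1) => [->|kSi]; first by rewrite eqxx; case: ifP; lia.
by do ?[case: ifP => ? //]; lia.
Qed.

Lemma nth_foldr_sswap u e k : in_range u ->
  nth 0 (foldr sswap e u) (foldr (@sw n) k u) = nth 0 e k.
Proof. by elim: u => //= i u IH /andP[ie /IH <-]; rewrite nth_sswap_sw. Qed.

Lemma pact_word w u e : in_range u -> (forall k, w k = foldr (@sw n) k u) ->
  size e = n -> pact w e = foldr sswap e u.
Proof.
move=> au wu en; apply: (@eq_from_nth _ 0) => [|k].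
  by rewrite size_foldr_sswap en // size_map size_enum_ord.
rewrite size_map size_enum_ord => kn.
rewrite (nth_map (Ordinal kn)) ?size_enum_ord //.
rewrite -(nth_foldr_sswap e _ au) -wu permKV; congr nth.
by rewrite nth_enum_ord.
Qed.

Lemma word_perm u : in_range u -> exists w, forall k, w k = foldr (@sw n) k u.
Proof.
move=> au; have inj : injective (fun k => foldr (@sw n) k u).
  by elim: u au => [_ k l //|i u IH /= /andP[ie /IH inj] k l /(sw_inj ie) /inj].
by exists (perm inj) => k; rewrite permE.
Qed.

(** Reduces lengths of permutations to inversions of sequences: [plen w] is the number of inversions
    here, and [w] sorts its own one-line notation. *)
Definition oneline w : seq nat := [seq val (w k) | k <- enum 'I_n].

Lemma size_oneline w : size (oneline w) = n.
Proof. by rewrite size_map size_enum_ord. Qed.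

Lemma nth_oneline w k : nth 0 (oneline w) k = w k.
Proof. by rewrite (nth_map k) ?size_enum_ord // nth_ord_enum. Qed.

Lemma inversionsE e : size e = n -> inversions e =
  \sum_(k < n) \sum_(l < n) ((k < l) && (nth 0 e l < nth 0 e k)).
Proof.
elim: e n => [|x e IH] m <-; first by rewrite big_ord0.
rewrite /= big_ord_recl big_ord_recl /= add0n (IH _ (erefl _)); congr (_ + _).
  rewrite -sum1_count (big_nth 0) big_mkord big_mkcond /=.
  by apply: eq_bigr => l _; case: (nth 0 e l < x).
by apply: eq_bigr => k _; rewrite big_ord_recl.
Qed.

Lemma plenE w : plen w = inversions (oneline w).
Proof.
rewrite (inversionsE (size_oneline w)) pair_bigA /plen -sum1_card big_mkcond /=.
apply: eq_bigr => -[k l] _ /=.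
by rewrite inE !nth_oneline /=; case: (_ && _).
Qed.

Lemma pact_oneline w : pact w (oneline w) = iota 0 n.
Proof.
rewrite -val_enum_ord; apply: eq_map => k.
by rewrite nth_oneline permKV.
Qed.

(** The word sorts [oneline w], and each of its swaps removes at most one inversion. *)
Lemma plen_word w u : in_range u -> (forall k, w k = foldr (@sw n) k u) ->
  plen w <= size u.
Proof.
move=> au wu; rewrite plenE.
have au' : all (fun i => i.+1 < size (oneline w)) u by rewrite size_oneline.
apply: leq_trans (inversions_foldr_sswap au') _.
rewrite -(pact_word au wu (size_oneline w)) pact_oneline.
by have /[!sorted_inversions]/eqP-> := iota_sorted 0 n; rewrite addn0.
Qed.

Lemma perm_foldr_sswap u e : all (fun i => i.+1 < size e) u ->
  perm_eq (foldr sswap e u) e.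
Proof.
elim: u => //= i u IH /andP[ie au].
by rewrite perm_sswap ?IH // size_foldr_sswap.
Qed.

Lemma perm_oneline w : perm_eq (oneline w) (iota 0 n).
Proof.
rewrite -val_enum_ord /oneline (map_comp val w) perm_map //.
apply: uniq_perm; rewrite ?(map_inj_uniq perm_inj) ?enum_uniq // => k.
by rewrite mem_enum; apply/mapP; exists ((w^-1)%g k); rewrite ?mem_enum ?permKV.
Qed.

(** A sorting word of [oneline w] represents some [v] that also carries it to [iota 0 n]; reading
    off positions gives [v = w]. *)
Lemma reduced_word_exists w : exists u, reduced_word w u.
Proof.
have [u /and3P[]] := sorting_word_exists (oneline w).
rewrite size_oneline => au /eqP su so; exists u; split=> //; rewrite plenE; split=> //.
have [v vu] := word_perm au.
have E : pact v (oneline w) = iota 0 n.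
  apply: (sorted_eq leq_trans anti_leq); rewrite ?iota_sorted //.
    by rewrite (pact_word au vu) // size_oneline.
  rewrite (pact_word au vu) ?size_oneline //.
  by apply: perm_trans (perm_oneline w); apply: perm_foldr_sswap; rewrite size_oneline.
move=> k; rewrite -vu; apply: val_inj.
have := congr1 (fun s => nth 0 s (v k)) E; rewrite /= nth_iota // add0n => <-.
by rewrite (nth_map k) ?size_enum_ord // nth_ord_enum permK nth_oneline.
Qed.

Lemma wminus_spec e : size e = n -> is_wminus e (wminus n e).
Proof.
move=> en; apply: epsilon_spec.
have [u /and3P[]] := sorting_word_exists e; rewrite en => au _ so.
have [v vu] := word_perm au; rewrite -(pact_word au vu en) in so.
have := @arg_minnP _ v (fun w => sorted leq (pact w e)) (@plen n) so.
by case=> w sw min; exists w.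
Qed.

(** The bridge from the chosen permutation and word to sorting words. Minimality among sorting
    permutations bounds the length above by [inversions e]; the lower bound holds because one swap
    removes at most one inversion. *)
Lemma rword_wminus e : size e = n -> sorting_word (rword (wminus n e)) e.
Proof.
move=> en; have [so min] := wminus_spec en.
set w := wminus n e in so min *.
have [au [wu su]] : reduced_word w (rword w).
  exact: epsilon_spec (reduced_word_exists w).
rewrite (pact_word au wu en) in so.
rewrite /sorting_word en au so andbT /= eqn_leq; apply/andP; split.
  have [x /and3P[]] := sorting_word_exists e; rewrite en => ax /eqP <- sx.
  have [v vx] := word_perm ax; rewrite su.
  by apply: leq_trans (plen_word ax vx); apply: min; rewrite (pact_word ax vx en).
have := @inversions_foldr_sswap e (rword w); rewrite en => /(_ au).
by move: so; rewrite sorted_inversions => /eqP->; rewrite addn0.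
Qed.

End Permutations.


(** * The qKZ family *)

Lemma rcons_nseq (X : Type) m (x : X) : rcons (nseq m x) x = nseq m.+1 x.
Proof. by elim: m => //= m ->. Qed.

Lemma sswap_rcons s i k : (i.+1 < size s)%N ->
  sswap i (rcons s k) = rcons (sswap i s) k.
Proof.
move=> si; apply: eq_seq_nth => [|l].
  by rewrite !(size_sswap, size_rcons) // ltnW.
rewrite !(nth_sswap, nth_rcons) size_sswap // si (ltnW si).
by do ?[case: ifP => ? //]; lia.
Qed.

Section Family.
Variables (R : realType) (n : nat) (ts : R[i]).
Hypothesis ts0 : ts != 0.
Variable E : LP R n.
Local Notation C := R[i].
Local Notation T := (@That R n ts).
Local Notation F := (fun e => Tw_inv ts (wminus n e) E).
Implicit Types (f g : LP R n) (e s t r : seq nat).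

Lemma lp_scaleA (a b : C) f : lp_scale a (lp_scale b f) = lp_scale (a * b) f.
Proof. by apply/fsfunP => x; rewrite !lp_scaleE mulrA. Qed.

Lemma lp_scale1 f : lp_scale 1 f = f.
Proof. by apply/fsfunP => x; rewrite lp_scaleE mul1r. Qed.

Lemma Tinv_comm i j f : (i.+1 < j)%N -> (j.+1 < n)%N ->
  Tinv ts i (Tinv ts j f) = Tinv ts j (Tinv ts i f).
Proof.
move=> ij jn; have lin : (i.+1 < n)%N by lia.
apply: (That_inj ts0 lin); apply: (That_inj ts0 jn).
by rewrite TinvK // -That_comm // !TinvK.
Qed.

Lemma Tinv_braid i f : (i.+2 < n)%N ->
  Tinv ts i (Tinv ts i.+1 (Tinv ts i f)) =
  Tinv ts i.+1 (Tinv ts i (Tinv ts i.+1 f)).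
Proof.
move=> ln; have lin : (i.+1 < n)%N by lia.
apply: (That_inj ts0 lin); apply: (That_inj ts0 ln); apply: (That_inj ts0 lin).
by rewrite !TinvK // That_braid // !TinvK.
Qed.

Lemma foldr_scale (S : nat -> LP R n -> LP R n) (c : C) f (u : seq nat) :
  (forall i g, i \in u -> S i (lp_scale c g) = lp_scale c (S i g)) ->
  foldr S (lp_scale c f) u = lp_scale c (foldr S f u).
Proof.
elim: u => //= i u IH h; rewrite IH ?h ?mem_head // => j g ju.
by rewrite h // in_cons ju orbT.
Qed.

Lemma foldr_That_inj f g (u : seq nat) : all (fun i => i.+1 < n)%N u ->
  foldr T f u = foldr T g u -> f = g.
Proof. by elim: u => //= i u IH /andP[ie /IH h] /(That_inj ts0 ie). Qed.

(** Appending [i] to a sorting word of [sswap i e] gives a sorting word of [e], and the product of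
    inverses does not depend on the sorting word. *)
Lemma family_descent e i : size e = n -> (i.+1 < n)%N ->
  (nth 0 e i.+1 < nth 0 e i)%N -> T i (F e) = F (sswap i e).
Proof.
move=> en ie de; have en' : size (sswap i e) = n by rewrite size_sswap ?en.
suff -> : F e = Tinv ts i (F (sswap i e)) by rewrite TinvK.
rewrite -[RHS](foldl_rcons (fun g i => Tinv ts i g)).
apply: (sorting_word_coherence (n := n) E _ _ en).
- exact: Tinv_comm.
- exact: Tinv_braid.
- exact: rword_wminus.
- by rewrite sorting_word_rcons en ie de rword_wminus.
Qed.

Lemma family_descent_cat s a b t : size (s ++ a :: b :: t) = n -> (b < a)%N ->
  T (size s) (F (s ++ a :: b :: t)) = F (s ++ b :: a :: t).
Proof.
move=> en ba; rewrite family_descent // ?sswap_cat //.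
  by rewrite -en size_cat /=; lia.
rewrite !nth_cat ltnn subnn; case: ifP => [|_]; first by lia.
by rewrite subSnn.
Qed.

Lemma family_sorted e : size e = n -> sorted leq e -> F e = E.
Proof.
move=> en; rewrite sorted_inversions => /eqP e0.
by have /and3P[_ /eqP + _] := rword_wminus en; rewrite e0 /Tw_inv => /size0nil->.
Qed.

(** Induction on inversions: a descent [j] of [e] is sorted first. If [j] is far from the plateau,
    the operators commute; if it is adjacent, a braid move shifts the plateau by one position. *)
Lemma family_equal (eta : C) delta :
  sorted leq delta ->
  (forall i, (i.+1 < n)%N -> nth 0%N delta i = nth 0%N delta i.+1 ->
     T i E = lp_scale eta E) ->
  forall e i, size e = n -> perm_eq e delta -> (i.+1 < n)%N ->
  nth 0%N e i = nth 0%N e i.+1 -> T i (F e) = lp_scale eta (F e).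
Proof.
move=> sd TE e; move: {2}(inversions e) (leqnn (inversions e)) => m.
elim: m e => [|m IH] e em i en ed ie ee.
  have se : sorted leq e by rewrite sorted_inversions -leqn0.
  rewrite family_sorted //; apply: TE => //.
  by rewrite -(sorted_eq leq_trans anti_leq se sd ed).
have [se|/descent_exists[j je dj]] := boolP (sorted leq e).
  apply: (IH e) => //; move: se; rewrite sorted_inversions => /eqP->; exact: leq0n.
have ej : (inversions (sswap j e) <= m)%N.
  by have := inversions_descent je dj; lia.
have szj : size (sswap j e) = n by rewrite size_sswap.
have pj : perm_eq (sswap j e) delta by rewrite perm_sswap.
rewrite en in je; have Fj := family_descent en je dj.
have [ij|ij|ij] := ltngtP i j; last by move: dj; rewrite -ij ee ltnn.
- have [ij'|ij'] := ltnP i.+1 j.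
    apply: (That_inj ts0 je); rewrite -That_comm // That_scale // Fj.
    by apply: IH => //; rewrite !nth_sswap; do ?[case: ifP => ? //=]; lia.
  (* Here [e] reads $a,a,b$ from position [i], with $b<a$; two descents turn this into $b,a,a$, with
     the plateau at [i.+1]. *)
  have ji : j = i.+1 by lia.
  subst j; have di : (nth 0 (sswap i.+1 e) i.+1 < nth 0 (sswap i.+1 e) i)%N.
    by rewrite !nth_sswap eqxx; do ?[case: ifP => ? //=]; lia.
  have szi : (i.+1 < size (sswap i.+1 e))%N by rewrite szj.
  have Fi := family_descent szj ie di.
  have IHi : T i.+1 (F (sswap i (sswap i.+1 e))) =
      lp_scale eta (F (sswap i (sswap i.+1 e))).
    have sz2 : size (sswap i (sswap i.+1 e)) = n by rewrite size_sswap.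
    have p2 : perm_eq (sswap i (sswap i.+1 e)) delta by rewrite perm_sswap.
    apply: IH => //.
      by have := inversions_descent szi di; lia.
    by rewrite !nth_sswap !eqxx; do ?[case: ifP => ? //=]; lia.
  apply: (That_inj ts0 je); apply: (That_inj ts0 ie).
  by rewrite That_braid // !That_scale // Fj Fi.
- have [ij'|ij'] := ltnP j.+1 i.
    apply: (That_inj ts0 je); rewrite That_comm // That_scale // Fj.
    by apply: IH => //; rewrite !nth_sswap; do ?[case: ifP => ? //=]; lia.
  (* Here [e] reads $a,b,b$ from position [j], with $b<a$; two descents turn this into $b,b,a$, with
     the plateau at [j]. *)
  have ji : i = j.+1 by lia.
  subst i; have di : (nth 0 (sswap j e) j.+2 < nth 0 (sswap j e) j.+1)%N.
    by rewrite !nth_sswap eqxx; do ?[case: ifP => ? //=]; lia.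
  have szi : (j.+2 < size (sswap j e))%N by rewrite szj.
  have Fi := family_descent szj ie di.
  have IHi : T j (F (sswap j.+1 (sswap j e))) =
      lp_scale eta (F (sswap j.+1 (sswap j e))).
    have sz2 : size (sswap j.+1 (sswap j e)) = n by rewrite size_sswap.
    have p2 : perm_eq (sswap j.+1 (sswap j e)) delta by rewrite perm_sswap.
    apply: IH => //.
      by have := inversions_descent szi di; lia.
    by rewrite !nth_sswap !eqxx; do ?[case: ifP => ? //=]; lia.
  apply: (That_inj ts0 je); apply: (That_inj ts0 ie).
  by rewrite -That_braid // !That_scale // Fj Fi.
Qed.

Lemma family_move_left s t k r : size (s ++ t ++ k :: r) = n ->
  all (fun x => k < x)%N t ->
  foldr T (F (s ++ t ++ k :: r)) (iota (size s) (size t)) = F (s ++ k :: t ++ r).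
Proof.
elim/last_ind: t r => [|t x IH] r //.
rewrite cat_rcons catA all_rcons size_rcons => en /andP[kx kt].
rewrite -addn1 iotaD foldr_cat /= -size_cat family_descent_cat // -catA.
rewrite IH ?cat_rcons //; rewrite -en !size_cat /=; lia.
Qed.

(** Carrying [k] leftwards past smaller letters creates one descent at a time, and each is undone by
    a step of [family_descent]; hence the inverses. *)
Lemma family_move_right s t k r : size (s ++ t ++ k :: r) = n ->
  all (fun x => x < k)%N t ->
  foldr (Tinv ts) (F (s ++ t ++ k :: r)) (iota (size s) (size t)) =
    F (s ++ k :: t ++ r).
Proof.
elim: t s => [|x t IH] s //= en /andP[xk tk].
have -> : s ++ x :: t ++ k :: r = rcons s x ++ t ++ k :: r by rewrite cat_rcons.
have en' : size (rcons s x ++ t ++ k :: r) = n by rewrite cat_rcons.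
rewrite -(size_rcons s x) IH // cat_rcons -family_descent_cat //.
  rewrite ThatTinv //; move: en; rewrite !size_cat /= size_cat /=; lia.
by rewrite -en !size_cat /= !size_cat /=; lia.
Qed.

Lemma foldr_Tinv_eigen (eta : C) m D : eta != 0 -> (m + D < n)%N ->
  (forall i, (m <= i < m + D)%N -> T i E = lp_scale eta E) ->
  foldr (Tinv ts) E (iota m D) = lp_scale (eta ^- D) E.
Proof.
move=> eta0; elim: D m => [|D IH] m mD TE; first by rewrite invr1 lp_scale1.
rewrite /= IH => [||i im]; [|lia|by apply: TE; lia].
have mn : (m.+1 < n)%N by lia.
rewrite Tinv_scale //; apply: (That_inj ts0 mn).
rewrite That_scale // TinvK // That_scale // TE ?lp_scaleA; last by lia.
by congr lp_scale; rewrite exprSr invfM mulfVK // -{1}[eta ^- D]mulr1.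
Qed.

(** [size A + D] is the last position of [k] in [delta]. In the corresponding [Yop], the inverses
    inside the block of [k] act on [E] by scalars, the other inverses bring one [k] to the front,
    and the operators after [omega] match those that sort a final [k] back past [B]. *)
Lemma family_rotate_sorted (p : R) (eta chi : C) A k D B :
  eta != 0 ->
  let delta := A ++ nseq D.+1 k ++ B in
  let s := A ++ nseq D k ++ B in
  size delta = n -> sorted leq delta ->
  all (fun x => x < k)%N A -> all (fun x => k < x)%N B ->
  (forall i, (i.+1 < n)%N -> nth 0%N delta i = nth 0%N delta i.+1 ->
     T i E = lp_scale eta E) ->
  Yop ts p (size A + D) E = lp_scale chi E ->
  omega p (F (k :: s)) = lp_scale (chi * eta ^+ D) (F (rcons s k)).
Proof.
move=> eta0 delta s dn sd Ak kB TE; rewrite /Yop.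
have szn : (size A + D + size B).+1 = n.
  by rewrite -dn /delta !size_cat size_nseq; lia.
have -> : (n.-1 - (size A + D))%N = size B by lia.
have EL : foldr T (F (rcons s k)) (iota (size A + D) (size B)) = E.
  have sE : rcons s k = (A ++ nseq D k) ++ B ++ [:: k].
    by rewrite /s -cats1 !catA.
  have := @family_move_left (A ++ nseq D k) B k [::].
  rewrite -sE size_cat size_nseq => -> //.
    rewrite cats0 -catA -cat_rcons rcons_nseq family_sorted //.
  by rewrite /s size_rcons !size_cat size_nseq -szn; lia.
have ER : foldr (Tinv ts) E (iota 0 (size A)) = F (k :: s).
  have := @family_move_right [::] A k (nseq D k ++ B).
  by rewrite -[A ++ k :: _]/delta family_sorted //= => ->.
have Bn : all (fun i => i.+1 < n)%N (iota (size A + D) (size B)).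
  by apply/allP => i; rewrite mem_iota; lia.
(* Indices from [size A] to [size A + D - 1] lie within the block of [k] and contribute [eta ^- D];
   the smaller ones are handled by [ER]. *)
rewrite iotaD foldr_cat add0n (@foldr_Tinv_eigen eta) //; last first.
- move=> i iA; apply: TE; first by lia.
  rewrite /delta !nth_cat !nth_nseq size_nseq.
  by do ?[case: ifP => ? //=]; lia.
- by lia.
rewrite foldr_scale => [|i g]; last first.
  by rewrite mem_iota => ?; rewrite Tinv_scale //; lia.
rewrite ER omega_scale foldr_scale => [h|i g]; last first.
  by rewrite mem_iota => ?; rewrite That_scale //; lia.
(* Both sides are compared after the injective product of [T i] over the positions of [B], which
   sends [F (rcons s k)] to [E]. *)
apply: (foldr_That_inj Bn); rewrite foldr_scale ?EL => [|i g]; last first.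
  by rewrite mem_iota => ?; rewrite That_scale //; lia.
rewrite mulrC -lp_scaleA -h lp_scaleA divff ?expf_neq0 //.
by rewrite lp_scale1.
Qed.

(** A descent [i] of [s] is sorted by [T i.+1] in [k :: s] and by [T i] in [rcons s k]. Since
    [omega] intertwines these two operators, the relation propagates from sorted [s]. *)
Lemma family_rotate (p : R) (c : C) delta k : p != 0 ->
  (forall s, sorted leq s -> perm_eq (rcons s k) delta ->
     omega p (F (k :: s)) = lp_scale c (F (rcons s k))) ->
  forall s, size (rcons s k) = n -> perm_eq (rcons s k) delta ->
  omega p (F (k :: s)) = lp_scale c (F (rcons s k)).
Proof.
move=> p0 base s; move: {2}(inversions s) (leqnn (inversions s)) => m.
elim: m s => [|m IH] s sm sn sd.
  by apply: base => //; rewrite sorted_inversions -leqn0.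
have [ss|/descent_exists[i si di]] := boolP (sorted leq s); first exact: base.
have Ei := inversions_descent si di.
have sni : (i.+2 < n)%N by rewrite -sn size_rcons.
have ps : perm_eq (rcons (sswap i s) k) delta.
  by apply: perm_trans sd; rewrite -!cats1 perm_cat2r perm_sswap.
have iw : (i.+1 < n)%N by exact: ltnW.
have ri : sswap i (rcons s k) = rcons (sswap i s) k by exact: sswap_rcons.
have Fr : T i (F (rcons s k)) = F (rcons (sswap i s) k).
  by rewrite -ri; apply: family_descent; rewrite ?nth_rcons ?si ?(ltnW si).
have Fl : T i.+1 (F (k :: s)) = F (k :: sswap i s).
  by apply: (@family_descent (k :: s)) => //; rewrite -sn size_rcons.
apply: (That_inj ts0 iw); rewrite -omega_That // Fl That_scale // Fr.
by apply: IH; rewrite ?size_rcons ?size_sswap -?(size_rcons s k) //; lia.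
Qed.

End Family.

(** * Constant blocks of the sorted sequence [delta] *)

Section Delta.
Variable d : nat -> nat.

Definition blocks m r : seq nat := flatten [seq nseq (d j) j | j <- iota m r].

Lemma mem_blocks m r x : x \in blocks m r -> (m <= x < m + r)%N.
Proof.
case/flatten_mapP => j; rewrite mem_iota => jm /nseqP[-> _]; exact: jm.
Qed.

Lemma size_blocks0 k : size (blocks 0 k) = (\sum_(l < k) d l)%N.
Proof.
elim: k => [|k IH]; first by rewrite big_ord0.
rewrite big_ord_recr /= -IH /blocks -[k.+1]addn1 iotaD map_cat flatten_cat size_cat.
by rewrite /= cats0 size_nseq.
Qed.

Lemma sorted_blocks m r : sorted leq (blocks m r).
Proof.
elim: r m => //= r IH m; rewrite -[blocks _ _]/(nseq (d m) m ++ blocks m.+1 r).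
have mle : all (leq m) (blocks m.+1 r).
  by apply/allP => x /mem_blocks; lia.
elim: (d m) => //= D IHD; rewrite (path_sortedE leq_trans) IHD all_cat mle.
by rewrite all_nseq leqnn orbT.
Qed.

Lemma delta_split N k : (k < N)%N ->
  delta N d = blocks 0 k ++ nseq (d k) k ++ blocks k.+1 (N - k.+1).
Proof.
move=> kN; rewrite /delta.
have {1}-> : N = (k + (N - k.+1).+1)%N by lia.
by rewrite iotaD map_cat flatten_cat.
Qed.

Lemma count_mem_delta N k : (k < N)%N -> count_mem k (delta N d) = d k.
Proof.
move=> kN; rewrite (delta_split kN) !count_cat count_nseq /= eqxx mul1n.
have cb m r : (k < m)%N || (m + r <= k)%N -> count_mem k (blocks m r) = 0%N.
  by move=> h; apply/count_memPn/negP => /mem_blocks; lia.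
by rewrite !cb ?ltnSn ?leqnn ?orbT ?addn0.
Qed.

Lemma inI_perm n N e : inI n N d e -> perm_eq e (delta N d).
Proof.
case=> _ [eN ce]; apply/allP => x; rewrite mem_cat /= => xin.
have xN : (x < N)%N.
  case/orP: xin => [/(allP eN)//|/mem_blocks]; lia.
by rewrite ce // count_mem_delta.
Qed.

End Delta.

Theorem theorem3p6 (R : realType) (n N : nat) (ts : R[i]) (p : R)
  (d : nat -> nat) (sg : bool) (E : LP R n) (chi : nat -> R[i]) :
  (2 <= N)%N -> (N <= n)%N -> ts != 0 -> 0 < p ->
  (forall j, (j < N)%N -> (0 < d j)%N) ->
  (\sum_(j < N) d j)%N = n ->
  (forall j, (j < n)%N -> lp_scaled (Yop ts p j E) (chi j) E) ->
  (forall i, (i.+1 < n)%N ->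
     nth 0%N (delta N d) i = nth 0%N (delta N d) i.+1 ->
     lp_scaled (That ts i E) (eta_of sg ts) E) ->
  qKZ_family ts p N d sg
    (fun i => chi (\sum_(l < i.+1) d l).-1 * eta_of sg ts ^+ (d i).-1)
    (fun e => Tw_inv ts (wminus n e) E).
Proof.
move=> N2 Nn ts0 p0 d0 dn YE TE.
have eta0 : eta_of sg ts != 0.
  by rewrite /eta_of; case: sg {TE} => //; rewrite oppr_eq0 invr_eq0.
have TE' i : (i.+1 < n)%N -> nth 0%N (delta N d) i = nth 0%N (delta N d) i.+1 ->
    That ts i E = lp_scale (eta_of sg ts) E.
  by move=> ie ee; apply/lp_scaledP/TE.
have sd : sorted leq (delta N d) by exact: sorted_blocks.
have szd : size (delta N d) = n by rewrite -dn -size_blocks0.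
split; [|split] => [e Ie i ie ee|e [en _] i ie de|e Ie].
- have [en _] := Ie; apply/lp_scaledP.
  exact: (family_equal ts0 sd TE' en (inI_perm Ie)).
- exact: family_descent.
have [en [eN _]] := Ie; have pe := inI_perm Ie; apply/lp_scaledP.
case/lastP: e en eN pe {Ie} => [|s k] en eN pe; first by move: en => /=; lia.
have -> : nth 0%N (rcons s k) n.-1 = k.
  by rewrite -en size_rcons nth_rcons ltnn eqxx.
have kN : (k < N)%N by move: eN; rewrite all_rcons => /andP[].
rewrite rotr1_rcons.
apply: (family_rotate ts0 (lt0r_neq0 p0) _ en pe) => {}s ss ps {en eN pe}.
have [D dD] : exists D, d k = D.+1 by case: (d k) (d0 k kN) => // D; exists D.
have dE := delta_split d kN; rewrite dD in dE.
(* The index of [chi] becomes [size A + D]: the predecessor turns the one-based last position of [k]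
   into the zero-based one. *)
rewrite big_ord_recr /= -size_blocks0 dD addnS /=.
set A := blocks d 0 k in dE *; set B := blocks d _ _ in dE.
have Ak : all (fun x => x < k)%N A by apply/allP => x /mem_blocks.
have kB : all (fun x => k < x)%N B by apply/allP => x /mem_blocks/andP[].
(* A sorted [s] is [delta] with one [k] removed, as two sorted rearrangements of the same letters
   coincide. *)
have sE : s = A ++ nseq D k ++ B.
  have pE : perm_eq s (A ++ nseq D k ++ B).
    rewrite -(perm_cons k); move: ps; rewrite perm_rcons dE.
    by move/perm_trans; apply; rewrite -[nseq D.+1 k]cat1s -catA perm_catCA.
  apply: (sorted_eq leq_trans anti_leq ss _ pE).
  apply: subseq_sorted sd; first exact: leq_trans.
  by rewrite dE cat_subseq // subseq_cons.
have := family_rotate_sorted ts0 eta0 (A := A) (k := k) (D := D) (B := B).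
rewrite sE -dE; apply=> //.
by apply/lp_scaledP/YE; rewrite -szd dE !size_cat size_nseq; lia.
Qed.
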